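(* Let $M=(E,r)$ be an arbitrary matroid on a finite set $E$ with rank function $r$. Then, as identities of rational functions in the variable $q$, $$\chi_{M^\perp}(q)=(q-1)^{|E|}\sum_{A\subseteq E}\Big(\frac{q}{1-q}\Big)^{|A|}\frac{\chi_{M|_A}(q)}{q^{r(A)}},$$ $$\chi_{M^\perp}(q)=q^{-r(E)}\sum_{A\subseteq E}(-1)^{|E|-|A|}(q-1)^{|A|}\chi_{M/A}(q).$$
   Context: For a matroid $N$ on ground set $S$ with rank function $r_N$, the characteristic polynomial is $\chi_N(x)=\sum_{X\subseteq S}(-1)^{|X|}x^{r_N(S)-r_N(X)}$. $M^\perp$ is the dual matroid on $E$ with rank function $r^\perp(A)=|A|-r(E)+r(E\setminus A)$. $M|_A$ is the restriction of $M$ to $A$ (ground set $A$, rank function $r$ restricted to subsets of $A$), and $M/A$ is the contraction of $A$ (ground set $E\setminus A$, rank function $X\mapsto r(X\cup A)-r(A)$). *)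

(* Defs.v *)
From mathcomp Require Import all_boot all_order all_algebra.
From mathcomp Require Import zify.

Set Implicit Arguments.
Unset Strict Implicit.
Unset Printing Implicit Defensive.

Import GRing.Theory.

(* The ground set is a finite subset of an ambient finite type, so that a      *)
(* matroid and its minors live in the same type.  The values of the rank       *)
(* function on sets not contained in the ground set are irrelevant.            *)
Record matroid (T : finType) := Matroid {
  ground : {set T};
  rk : {set T} -> nat;
  rk_le_card : forall X : {set T}, X \subset ground -> rk X <= #|X|;
  rk_mono : forall X Y : {set T}, X \subset Y -> Y \subset ground ->
    rk X <= rk Y;
  rk_submod : forall X Y : {set T}, X \subset ground -> Y \subset ground ->
    rk (X :|: Y) + rk (X :&: Y) <= rk X + rk Y
}.

Section Constructions.
Variables (T : finType) (M : matroid T).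
Local Notation E := (ground M).
Local Notation r := (rk M).

(* |A| - r(E) + r(E \ A), reordered so that the subtraction does not truncate  *)
(* (dual_rk_spec).                                                             *)
Definition dual_rk (A : {set T}) : nat := #|A| + r (E :\: A) - r E.

Lemma rk_diff (A B : {set T}) : A \subset B -> B \subset E ->
  r (E :\: A) <= r (E :\: B) + #|B :\: A|.
Proof.
move=> sAB sBE; have sBAE : B :\: A \subset E by
  apply: subset_trans sBE; apply: subsetDl.
have -> : E :\: A = (E :\: B) :|: (B :\: A).
  apply/setP=> x; rewrite !inE.
  have := subsetP sAB x; have := subsetP sBE x.
  by case: (x \in A); case: (x \in B); case: (x \in E) => //= H1 H2;
    (have := H1 isT) || (have := H2 isT).
have := rk_submod (subsetDl E B) sBAE; have := rk_le_card sBAE; lia.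
Qed.

Lemma dual_rk_spec (A : {set T}) : A \subset E ->
  dual_rk A + r E = #|A| + r (E :\: A).
Proof.
by move=> sAE; have := rk_diff (sub0set A) sAE; rewrite !setD0 /dual_rk; lia.
Qed.

Lemma dual_rk_le_card (A : {set T}) : A \subset E -> dual_rk A <= #|A|.
Proof.
by move=> _; have := rk_mono (subsetDl E A) (subxx E); rewrite /dual_rk; lia.
Qed.

Lemma dual_rk_mono (A B : {set T}) : A \subset B -> B \subset E ->
  dual_rk A <= dual_rk B.
Proof.
move=> sAB sBE; have := rk_diff sAB sBE.
by have := cardsID A B; rewrite (setIidPr sAB) /dual_rk; lia.
Qed.

Lemma dual_rk_submod (A B : {set T}) : A \subset E -> B \subset E ->
  dual_rk (A :|: B) + dual_rk (A :&: B) <= dual_rk A + dual_rk B.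
Proof.
move=> sA sB; have sU : A :|: B \subset E by rewrite subUset sA.
have sI : A :&: B \subset E by apply: subset_trans sA; apply: subsetIl.
have := dual_rk_spec sA; have := dual_rk_spec sB.
have := dual_rk_spec sU; have := dual_rk_spec sI; rewrite setDUr setDIr.
have := rk_submod (subsetDl E A) (subsetDl E B); have := cardsUI A B; lia.
Qed.

Definition dual : matroid T :=
  Matroid dual_rk_le_card dual_rk_mono dual_rk_submod.

Section Minors.
Variable A : {set T}.

(* Minors are made total in A by intersecting with the ground set; for         *)
(* A \subset E one has E :&: A = A.                                            *)
Lemma restrict_le_card (X : {set T}) : X \subset E :&: A -> r X <= #|X|.
Proof. by rewrite subsetI => /andP[sX _]; apply: rk_le_card. Qed.

Lemma restrict_mono (X Y : {set T}) : X \subset Y -> Y \subset E :&: A ->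
  r X <= r Y.
Proof. by move=> sXY; rewrite subsetI => /andP[sY _]; apply: rk_mono. Qed.

Lemma restrict_submod (X Y : {set T}) :
    X \subset E :&: A -> Y \subset E :&: A ->
  r (X :|: Y) + r (X :&: Y) <= r X + r Y.
Proof.
by rewrite !subsetI => /andP[sX _] /andP[sY _]; apply: rk_submod.
Qed.

Definition restriction : matroid T :=
  Matroid restrict_le_card restrict_mono restrict_submod.

Definition contract_rk (X : {set T}) : nat :=
  r (X :|: (E :&: A)) - r (E :&: A).

Lemma contract_sub (X : {set T}) : X \subset E :\: A ->
  X :|: (E :&: A) \subset E.
Proof.
by move=> sX; rewrite subUset subsetIl (subset_trans sX (subsetDl _ _)).
Qed.

Lemma contract_le_card (X : {set T}) : X \subset E :\: A ->
  contract_rk X <= #|X|.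
Proof.
move=> sX; have sXE := subset_trans sX (subsetDl _ _).
have := rk_submod sXE (subsetIl E A); have := rk_le_card sXE.
rewrite /contract_rk; lia.
Qed.

Lemma contract_mono (X Y : {set T}) : X \subset Y -> Y \subset E :\: A ->
  contract_rk X <= contract_rk Y.
Proof.
move=> sXY sY; apply: leq_sub2r.
exact: rk_mono (setSU _ sXY) (contract_sub sY).
Qed.

Lemma contract_submod (X Y : {set T}) :
    X \subset E :\: A -> Y \subset E :\: A ->
  contract_rk (X :|: Y) + contract_rk (X :&: Y) <=
  contract_rk X + contract_rk Y.
Proof.
move=> sX sY; have cX := contract_sub sX; have cY := contract_sub sY.
have := rk_submod cX cY; rewrite -setUUl -setUIl.
have := rk_mono (subsetUr X _) cX; have := rk_mono (subsetUr Y _) cY.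
have sI : X :&: Y \subset E :\: A by apply: subset_trans sX; apply: subsetIl.
have sU : X :|: Y \subset E :\: A by rewrite subUset sX.
have := rk_mono (subsetUr (X :&: Y) _) (contract_sub sI).
have := rk_mono (subsetUr (X :|: Y) _) (contract_sub sU).
rewrite /contract_rk; lia.
Qed.

Definition contraction : matroid T :=
  Matroid contract_le_card contract_mono contract_submod.

End Minors.
End Constructions.

Local Open Scope ring_scope.

Definition chi (T : finType) (N : matroid T) : {poly int} :=
  \sum_(X : {set T} | X \subset ground N)
    (-1) ^+ #|X| * 'X ^+ (rk N (ground N) - rk N X)%N.

(* Frac(Z[q]) = Q(q), the field of rational functions in q. *)
Definition q : {fraction {poly int}} := tofrac 'X.

Definition chiq (T : finType) (N : matroid T) : {fraction {poly int}} :=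
  tofrac (chi N).

(* Main.v *)
Require Import Defs.
From mathcomp Require Import all_boot all_order all_algebra.
From mathcomp Require Import ring.

(** Let [G_M(t, y) = \sum_(X \subset E) t^|X| y^r(X)], so that
    [chi_M(q) = q^r(E) G_M(-1, 1/q)], and duality gives
    [chi_{M^perp}(q) = (-1)^|E| G_M(-q, 1/q)].  By the binomial formula, a sum
    over the restrictions of [M] rescales [t] and a sum over its contractions
    translates [t].  The two expansions of [G_M(-q, 1/q)] come from writing
    [-q = q * (-1)] and [-q = (1 - q) + (-1)]. *)

Set Implicit Arguments.
Unset Strict Implicit.
Unset Printing Implicit Defensive.

Import GRing.Theory.
Local Open Scope ring_scope.

Lemma setDD_setI (T : finType) (A B : {set T}) : A :\: (A :\: B) = A :&: B.
Proof. by rewrite setDDr setDv set0U. Qed.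

Section BigSubset.

Variables (R : Type) (idx : R) (op : Monoid.com_law idx) (T : finType).
Implicit Types (A E : {set T}) (F : {set T} -> R).

Lemma big_subset_setD E F :
  \big[op/idx]_(X : {set T} | X \subset E) F X =
  \big[op/idx]_(X : {set T} | X \subset E) F (E :\: X).
Proof.
rewrite (reindex_onto (setD E) (setD E)) => [|X sXE].
  by apply: eq_bigl => X; rewrite subsetDl setDD_setI (sameP eqP setIidPr).
by rewrite setDD_setI (setIidPr sXE).
Qed.

Lemma big_subset_interval A E F : A \subset E ->
  \big[op/idx]_(Y : {set T} | (A \subset Y) && (Y \subset E)) F Y =
  \big[op/idx]_(X : {set T} | X \subset E :\: A) F (X :|: A).
Proof.
move=> sAE; rewrite (reindex_onto (fun X => X :|: A) (fun Y => Y :\: A)) =>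
    [|Y /andP[sAY _]].
  apply: eq_bigl => X; rewrite subsetUr subUset sAE andbT subsetD.
  by rewrite setDUl setDv setU0 (sameP eqP setDidPl).
by rewrite setUC -{1}(setIidPr sAY) setID.
Qed.

End BigSubset.

Section BinomialSums.

Variables (R : comPzSemiRingType) (T : finType).
Implicit Types (E X : {set T}) (s t : R).

Lemma prodrD_subset E (F G : T -> R) :
  \prod_(i in E) (F i + G i) =
  \sum_(A : {set T} | A \subset E)
    (\prod_(i in A) F i) * \prod_(i in E :\: A) G i.
Proof.
pose F0 i := if i \in E then F i else 0.
pose G1 i := if i \in E then G i else 1.
have -> : \prod_(i in E) (F i + G i) = \prod_i (F0 i + G1 i).
  rewrite big_mkcond; apply: eq_bigr => i _.
  by rewrite /F0 /G1; case: ifP; rewrite ?add0r.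
rewrite bigA_distr [RHS]big_mkcond; apply: eq_bigr => A _.
case: ifPn => [/subsetP sAE | /subsetPn[i iA iNE]]; last first.
  by rewrite (bigD1 i) //= iA /F0 (negPf iNE) mul0r.
rewrite [\prod_(i in A) _]big_mkcond [\prod_(i in E :\: A) _]big_mkcond.
rewrite -big_split; apply: eq_bigr => i _; rewrite inE /F0 /G1.
by case: (boolP (i \in A)) => [/sAE ->|_] /=; rewrite ?mulr1 ?mul1r.
Qed.

Lemma sum_expr_subset E s t :
  \sum_(A : {set T} | A \subset E) s ^+ #|A| * t ^+ #|E :\: A| =
  (s + t) ^+ #|E|.
Proof.
rewrite -prodr_const prodrD_subset.
by apply: eq_bigr => A _; rewrite !prodr_const.
Qed.

Lemma sum_expr_interval X E s t : X \subset E ->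
  \sum_(A : {set T} | (X \subset A) && (A \subset E))
    s ^+ #|A| * t ^+ #|E :\: A| = s ^+ #|X| * (s + t) ^+ #|E :\: X|.
Proof.
move=> sXE; rewrite big_subset_interval // -sum_expr_subset mulr_sumr.
apply: eq_bigr => A; rewrite subsetD => /andP[_ /disjoint_setI0 dAX].
rewrite cardsU dAX cards0 subn0 setUC -setDDl addnC.
by rewrite exprD mulrA.
Qed.

End BinomialSums.

Lemma rk_set0 (T : finType) (M : matroid T) : rk M set0 = 0%N.
Proof. by apply/eqP; rewrite -leqn0 -(cards0 T) rk_le_card ?sub0set. Qed.

Section RankGeneratingFunction.

Variables (R : comPzRingType) (T : finType).
Implicit Types (M : matroid T) (A : {set T}) (s t w y : R).

Definition rank_genfun M t y : R :=
  \sum_(X : {set T} | X \subset ground M) t ^+ #|X| * y ^+ rk M X.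

Lemma rank_genfun_dual M w t y : w * (t * y) = 1 ->
  y ^+ rk M (ground M) * rank_genfun (dual M) t y =
  (t * y) ^+ #|ground M| * rank_genfun M w y.
Proof.
move=> wty1; rewrite /rank_genfun big_subset_setD !mulr_sumr.
apply: eq_bigr => X sXE /=; set E := ground M in sXE *.
have rk_dual : (rk M E + dual_rk M (E :\: X) = #|E :\: X| + rk M X)%N.
  have := dual_rk_spec (subsetDl E X).
  by rewrite setDD_setI (setIidPr sXE) addnC.
rewrite -(cardsID X E) (setIidPr sXE) addnC mulrCA -exprD rk_dual !exprD.
rewrite mulrA -exprMn -mulrA; congr (_ * _).
by rewrite mulrA -exprMn [t * y * w]mulrC wty1 expr1n mul1r.
Qed.

Lemma rank_genfun_restriction M A t y : A \subset ground M ->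
  rank_genfun (restriction M A) t y =
  \sum_(X : {set T} | X \subset A) t ^+ #|X| * y ^+ rk M X.
Proof. by move=> sAE; rewrite /rank_genfun /= (setIidPr sAE). Qed.

Lemma rank_genfun_contraction M A t y : A \subset ground M ->
  y ^+ rk M A * rank_genfun (contraction M A) t y =
  \sum_(Y : {set T} | (A \subset Y) && (Y \subset ground M))
    t ^+ #|Y :\: A| * y ^+ rk M Y.
Proof.
move=> sAE; rewrite /rank_genfun big_subset_interval //= mulr_sumr.
apply: eq_bigr => X; rewrite subsetD => /andP[sXE /setDidPl dXA].
rewrite mulrCA -exprD /contract_rk (setIidPr sAE) setDUl setDv setU0 dXA.
by rewrite subnKC // rk_mono ?subsetUr // subUset sXE.
Qed.

Lemma sum_rank_genfun_restriction M s t y :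
  \sum_(A : {set T} | A \subset ground M)
    s ^+ #|A| * (1 - s) ^+ #|ground M :\: A| *
    rank_genfun (restriction M A) t y = rank_genfun M (s * t) y.
Proof.
under eq_bigr => A sAE do rewrite rank_genfun_restriction // mulr_sumr.
rewrite (exchange_big_dep (fun X : {set T} => X \subset ground M)) => /= [|A X].
  apply: eq_bigr => X sXE; rewrite -mulr_suml.
  under eq_bigl do rewrite andbC.
  by rewrite sum_expr_interval // subrKC expr1n mulr1 mulrA -exprMn.
by move=> sAE /subset_trans; apply.
Qed.

Lemma sum_rank_genfun_contraction M s t y :
  \sum_(A : {set T} | A \subset ground M)
    s ^+ #|A| * (y ^+ rk M A * rank_genfun (contraction M A) t y) =
  rank_genfun M (s + t) y.
Proof.
under eq_bigr => A sAE do rewrite rank_genfun_contraction // mulr_sumr.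
rewrite (exchange_big_dep (fun Y : {set T} => Y \subset ground M)) => /= [|A Y].
  apply: eq_bigr => Y sYE; rewrite -sum_expr_subset mulr_suml.
  apply: eq_big => [A|A _]; last by rewrite mulrA.
  by rewrite sYE andbT andbC andb_idr // => /subset_trans; apply.
by move=> _ /andP[].
Qed.

End RankGeneratingFunction.

Section CharacteristicPolynomial.

Variables (R : comUnitRingType) (f : {rmorphism {poly int} -> R}).
Variables (T : finType).
Implicit Types (M N : matroid T) (A : {set T}).
Local Notation x := (f 'X).
Hypothesis x_unit : x \is a GRing.unit.

Lemma rmorph_chi N :
  f (chi N) = x ^+ rk N (ground N) * rank_genfun N (-1) x^-1.
Proof.
rewrite /chi /rank_genfun rmorph_sum mulr_sumr; apply: eq_bigr => X sXE.
rewrite rmorphM !rmorphXn rmorphN1 exprB ?rk_mono //.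
by rewrite mulrCA exprVn.
Qed.

Lemma rmorph_chi_dual M :
  f (chi (dual M)) = (-1) ^+ #|ground M| * rank_genfun M (- x) x^-1.
Proof.
set E := ground M.
have rk_dual : (dual_rk M E + rk M E = #|E|)%N.
  by rewrite dual_rk_spec // setDv rk_set0 addn0.
have x_dual : x ^+ dual_rk M E = x ^+ #|E| * x^-1 ^+ rk M E.
  by rewrite -rk_dual exprD -mulrA -exprMn divrr // expr1n mulr1.
rewrite rmorph_chi /= -/E x_dual -mulrA (@rank_genfun_dual _ _ _ (- x)).
  by rewrite mulrA -exprMn mulrCA divrr // mulr1.
by rewrite mulN1r mulrNN divrr.
Qed.

Lemma rmorph_chi_restriction M A : A \subset ground M ->
  f (chi (restriction M A)) / x ^+ rk M A =
  rank_genfun (restriction M A) (-1) x^-1.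
Proof.
by move=> sAE; rewrite rmorph_chi /= (setIidPr sAE) mulrC mulKr ?unitrX.
Qed.

Lemma rmorph_chi_contraction M A : A \subset ground M ->
  f (chi (contraction M A)) =
  x ^+ rk M (ground M) *
    (x^-1 ^+ rk M A * rank_genfun (contraction M A) (-1) x^-1).
Proof.
move=> sAE; rewrite rmorph_chi /= /contract_rk setUC setID (setIidPr sAE).
by rewrite exprB ?rk_mono // exprVn mulrA.
Qed.

Lemma rmorph_chi_dual_restriction M : 1 - x \is a GRing.unit ->
  f (chi (dual M)) =
    (x - 1) ^+ #|ground M| *
    \sum_(A : {set T} | A \subset ground M)
      (x / (1 - x)) ^+ #|A| * (f (chi (restriction M A)) / x ^+ rk M A).
Proof.
move=> oneBx_unit.
rewrite rmorph_chi_dual -[- x in LHS]mulrN1 -sum_rank_genfun_restriction.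
rewrite !mulr_sumr; apply: eq_bigr => A sAE.
rewrite rmorph_chi_restriction // cardsDS // exprB ?subset_leq_card //.
rewrite -[x - 1]opprB (exprNn (1 - x)) exprMn exprVn.
by ring.
Qed.

Lemma rmorph_chi_dual_contraction M :
  f (chi (dual M)) =
    x ^- rk M (ground M) *
    \sum_(A : {set T} | A \subset ground M)
      (-1) ^+ (#|ground M| - #|A|) * (x - 1) ^+ #|A| *
        f (chi (contraction M A)).
Proof.
have split_opp_x : - x = (1 - x) + -1 by ring.
rewrite rmorph_chi_dual split_opp_x -sum_rank_genfun_contraction.
rewrite !mulr_sumr; apply: eq_bigr => A sAE.
rewrite rmorph_chi_contraction // [RHS]mulrCA mulKr ?unitrX //.
rewrite -{1}(subnK (subset_leq_card sAE)) exprD.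
by rewrite -[x - 1]opprB (exprNn (1 - x)) !mulrA.
Qed.

End CharacteristicPolynomial.

Theorem theorem2 (T : finType) (M : matroid T) :
  chiq (dual M) =
    (q - 1) ^+ #|ground M| *
    \sum_(A : {set T} | A \subset ground M)
      (q / (1 - q)) ^+ #|A| * (chiq (restriction M A) / q ^+ rk M A)
  /\
  chiq (dual M) =
    q ^- rk M (ground M) *
    \sum_(A : {set T} | A \subset ground M)
      (-1) ^+ (#|ground M| - #|A|) * (q - 1) ^+ #|A| * chiq (contraction M A).
Proof.
have q_unit : q \is a GRing.unit by rewrite unitfE tofrac_eq0 polyX_eq0.
have oneBq_unit : 1 - q \is a GRing.unit.
  by rewrite -unitrN opprB unitfE -tofrac1 -tofracB tofrac_eq0 polyXsubC_eq0.
split.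
- exact: (rmorph_chi_dual_restriction (f := @tofrac _) q_unit M oneBq_unit).
- exact: (rmorph_chi_dual_contraction (f := @tofrac _) q_unit M).
Qed.
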